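(* There is an algorithm which, given the type $\frac{a_1|a_2|\cdots|a_k}{b_1|b_2|\cdots|b_m}$ of a meander, computes the index of the meander in time linear in the order $n=\sum_i a_i=\sum_j b_j$ of the meander.
   Context: Let $n$ be a positive integer and let $(a_1,\ldots,a_k)$ and $(b_1,\ldots,b_m)$ be two ordered sequences of positive integers, each with sum $n$. The meander of type $\frac{a_1|a_2|\cdots|a_k}{b_1|b_2|\cdots|b_m}$ is the (multi)graph on vertices $v_1,\ldots,v_n$ placed left to right on a line, constructed as follows. Split $v_1,\ldots,v_n$ into consecutive top blocks of sizes $a_1,\ldots,a_k$, and also into consecutive bottom blocks of sizes $b_1,\ldots,b_m$. For each top block, with vertices $v_p,\ldots,v_q$, add the top edges $v_{p+i}v_{q-i}$ for all $i\ge 0$ with $p+i<q-i$. For each bottom block add bottom edges in the same way. A pair of vertices joined by both a top edge and a bottom edge forms a cycle. Every connected component is a path (possibly a single vertex) or a cycle. The order of the meander is its number of vertices $n$. The index of the meander is $2C+P-1$, where $C$ is the number of cycles and $P$ the number of paths. *)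

(* Defs.v *)
From mathcomp Require Import all_boot.
Set Implicit Arguments.
Unset Strict Implicit.
Unset Printing Implicit Defensive.

(** * Meanders

    A multigraph on a vertex type [T] is given by the list of its edges, with
    repetitions; an entry [(u, v)] stands for the unordered pair {u, v}. *)

Definition mult (T : eqType) (E : seq (T * T)) (u v : T) : nat :=
  count (fun e => (e == (u, v)) || (e == (v, u))) E.

(* Vertices are numbered from 0, so that the first block, of size [x], of a
   sequence starting at vertex [p] is p, ..., q with q = p + x - 1. *)
Fixpoint block_edges (p : nat) (a : seq nat) : seq (nat * nat) :=
  if a is x :: a' then
    [seq (p + i, (p + x).-1 - i) | i <- iota 0 x & p + i < (p + x).-1 - i]
      ++ block_edges (p + x) a'
  else [::].

(* A pair joined by a top and a bottom edge occurs twice in this list. *)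
Definition meander_edges (a b : seq nat) : seq (nat * nat) :=
  block_edges 0 a ++ block_edges 0 b.

Section Components.
Variables (n : nat) (E : seq (nat * nat)).

Definition adj : rel 'I_n := fun u v => 0 < mult E u v.

Definition components : {set {set 'I_n}} :=
  [set [set v | connect adj u v] | u : 'I_n].

(* The multigraph induced on [K] has exactly the edges listed in [F]. *)
Definition induced_edges (K : {set 'I_n}) (F : seq ('I_n * 'I_n)) : bool :=
  [forall u in K, forall v in K, mult E u v == mult F u v].

Definition is_path (K : {set 'I_n}) : bool :=
  [exists s : #|K|.-tuple 'I_n,
    [&& uniq s, [set:: s] == K & induced_edges K (zip s (behead s))]].

(* For two vertices x, y the list is (x, y), (y, x), i.e. a double edge; for
   one vertex it is a loop, which never occurs in a meander. *)
Definition is_cycle (K : {set 'I_n}) : bool :=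
  [exists s : #|K|.-tuple 'I_n,
    [&& uniq s, [set:: s] == K & induced_edges K (zip s (rot 1 s))]].

Definition num_paths : nat := #|[set K in components | is_path K]|.
Definition num_cycles : nat := #|[set K in components | is_cycle K]|.

End Components.

(* The truncated subtraction is harmless: a meander of positive order has at
   least one component. *)
Definition meander_index (n : nat) (a b : seq nat) : nat :=
  2 * num_cycles n (meander_edges a b) + num_paths n (meander_edges a b) - 1.

(** * Random access machines

    The machine of Cook and Reckhow, with natural-number registers (hence
    truncated subtraction), sequential input and uniform cost.  It halts when
    the program counter leaves the program; its result is then register 0. *)

Inductive instr : Type :=
| IConst of nat & nat
| IAdd of nat & nat & nat
| ISub of nat & nat & nat
| ILoad of nat & nat
| IStore of nat & nat
| IJpos of nat & nat
| IRead of nat.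

Definition program := seq instr.

Record config := Config { pc : nat; reg : nat -> nat; input : seq nat }.

Definition set_reg (r : nat -> nat) (i v : nat) : nat -> nat :=
  fun j => if j == i then v else r j.

Definition exec (c : instr) (s : config) : config :=
  let: Config l r x := s in
  match c with
  | IConst i c => Config l.+1 (set_reg r i c) x
  | IAdd i j k => Config l.+1 (set_reg r i (r j + r k)) x
  | ISub i j k => Config l.+1 (set_reg r i (r j - r k)) x
  | ILoad i j => Config l.+1 (set_reg r i (r (r j))) x
  | IStore i j => Config l.+1 (set_reg r (r i) (r j)) x
  | IJpos j l' => Config (if 0 < r j then l' else l.+1) r x
  | IRead i => Config l.+1 (set_reg r i (head 0 x)) (behead x)
  end.

Definition step (P : program) (s : config) : config :=
  if onth P (pc s) is Some c then exec c s else s.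

Definition halted (P : program) (s : config) : bool := size P <= pc s.

Definition init (x : seq nat) : config := Config 0 (fun _ => 0) x.

Definition run (P : program) (x : seq nat) (t : nat) : config :=
  iter t (step P) (init x).

(* As usual with uniform cost, the machine works with short words: every value
   occurring in a register during the computation must be less than [W]. *)
Definition computes_within (P : program) (W T : nat) (x : seq nat) (y : nat) :
  Prop :=
  exists t : nat,
    [/\ t <= T, halted P (run P x t), reg (run P x t) 0 = y
      & forall t' i : nat, t' <= t -> reg (run P x t') i < W].

(* The order is not part of the input. *)
Definition encode_type (a b : seq nat) : seq nat :=
  size a :: a ++ size b :: b.

(* Main.v *)
(** Let [s] and [t] be the involutions that reverse each top block, resp. each
    bottom block.  A component that is a path is a single orbit of [s * t],
    because the walk along the path turns back at both ends; a cycle consists of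
    two orbits, exchanged by [s].  Hence [2 C + P] is the number of orbits of
    [s * t], and the index is computed by counting the cycles of a permutation.

    The machine stores [s * t] and its inverse as two arrays and then visits the
    vertices once, from right to left.  Bypassing the current vertex in its
    cycle multiplies the permutation by a transposition and creates a fixed
    point, so the orbits are exactly the vertices that are fixed when their turn
    comes.  This takes constant time per vertex, without marking visited
    vertices. *)

Require Import Defs.
From mathcomp Require Import all_boot all_fingroup zify.
Set Implicit Arguments.
Unset Strict Implicit.
Unset Printing Implicit Defensive.

(** * Recognizing paths and cycles *)

Section EdgeMultiplicity.
Variables (T : eqType) (x0 : T) (s : seq T) (f : nat -> nat) (l : nat).
Hypotheses (uniq_s : uniq s) (le_ls : l <= size s).
Hypothesis lt_fs : forall i, i < l -> f i < size s.

Let F := mkseq (fun m => (nth x0 s m, nth x0 s (f m))) l.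

(** Entry [m] can match only if [m] is [i] or [j], and [i != j] makes these cases exclusive, so the
    counts add up. Paths take the successor for [f], cycles the successor modulo the size. *)
Lemma mult_mkseq i j : i < size s -> j < size s -> i != j ->
  mult F (nth x0 s i) (nth x0 s j)
  = ((i < l) && (f i == j)) + ((j < l) && (f j == i)).
Proof.
move=> lis ljs neq_ij; rewrite /mult /F /mkseq count_map.
have count1 (p q : nat) : count (fun m => (m == p) && (f p == q)) (iota 0 l)
    = (p < l) && (f p == q).
  case: (f p == q); last first.
    by rewrite andbF (eq_count (a2 := pred0)) ?count_pred0 // => m; rewrite andbF.
  rewrite andbT (eq_count (a2 := pred1 p)) => [|m]; last by rewrite andbT.
  by rewrite count_uniq_mem ?iota_uniq // mem_iota.
rewrite -!count1 -count_predUI [X in _ = _ + X](eq_count (a2 := pred0)).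
  rewrite count_pred0 addn0; apply: eq_in_count => m /=.
  rewrite mem_iota /= add0n => lml; have lms := leq_trans lml le_ls.
  rewrite !xpair_eqE !nth_uniq ?lt_fs //.
  congr (_ || _); first by case: eqP => // ->.
  by rewrite andbC; case: (m =P j) => [->|]; rewrite ?andbF ?andbT.
move=> m /=; apply/negP => /andP[/andP[/eqP-> _] /andP[/eqP eq_ij _]].
by rewrite eq_ij eqxx in neq_ij.
Qed.

Lemma mult_mkseq_diag i : i < size s ->
  mult F (nth x0 s i) (nth x0 s i) = (i < l) && (f i == i).
Proof.
move=> lis; rewrite /mult /F /mkseq count_map.
rewrite (eq_in_count (a2 := fun m => (m == i) && (f i == i))).
  case: (f i == i); last first.
    by rewrite andbF (eq_count (a2 := pred0)) ?count_pred0 // => m; rewrite andbF.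
  rewrite andbT (eq_count (a2 := pred1 i)) => [|m]; last by rewrite andbT.
  by rewrite count_uniq_mem ?iota_uniq // mem_iota.
move=> m /=; rewrite mem_iota /= add0n orbb => lml.
rewrite xpair_eqE !nth_uniq ?lt_fs // ?(leq_trans lml) //.
by case: eqP => // ->.
Qed.

End EdgeMultiplicity.

Section Walks.
Variables (T : eqType) (x0 : T) (s : seq T).
Hypothesis uniq_s : uniq s.

Lemma zip_behead : zip s (behead s)
  = mkseq (fun m => (nth x0 s m, nth x0 s m.+1)) (size s).-1.
Proof.
apply: (@eq_from_nth _ (x0, x0)); first by rewrite size_zip size_mkseq size_behead; lia.
move=> i; rewrite size_zip size_behead => Hi.
rewrite nth_zip_cond size_zip size_behead Hi nth_mkseq ?nth_behead //; lia.
Qed.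

Lemma zip_rot1 : zip s (rot 1 s)
  = mkseq (fun m => (nth x0 s m, nth x0 s (m.+1 %% size s))) (size s).
Proof.
apply: (@eq_from_nth _ (x0, x0)); first by rewrite size_zip size_mkseq size_rot minnn.
move=> i; rewrite size_zip size_rot minnn => Hi.
rewrite nth_zip ?size_rot // nth_mkseq //; congr (_, _).
case: s Hi => // x s' /= Hi; rewrite rot1_cons nth_rcons.
case: (ltngtP i (size s')) Hi => [lti|gti|->] Hi; last by rewrite modnn.
  by rewrite modn_small.
lia.
Qed.

Lemma mult_path i j : i < size s -> j < size s ->
  mult (zip s (behead s)) (nth x0 s i) (nth x0 s j) = (i.+1 == j) + (j.+1 == i).
Proof.
move=> lis ljs; rewrite zip_behead.
have lts m : m < (size s).-1 -> m.+1 < size s by lia.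
have [<-|neq_ij] := eqVneq i j.
  by rewrite (mult_mkseq_diag x0 uniq_s (leq_pred _) lts) //; lia.
by rewrite (mult_mkseq x0 uniq_s (leq_pred _) lts) //; lia.
Qed.

Lemma mult_cycle i j : i < size s -> j < size s -> i != j ->
  mult (zip s (rot 1 s)) (nth x0 s i) (nth x0 s j)
  = (i.+1 %% size s == j) + (j.+1 %% size s == i).
Proof.
move=> lis ljs neq_ij; rewrite zip_rot1.
have lts m : m < size s -> m.+1 %% size s < size s by rewrite ltn_pmod; lia.
by rewrite (mult_mkseq x0 uniq_s (leqnn _) lts) // lis ljs.
Qed.

Lemma mult_cycle_diag i : i < size s ->
  mult (zip s (rot 1 s)) (nth x0 s i) (nth x0 s i) = (i.+1 %% size s == i).
Proof.
move=> lis; rewrite zip_rot1.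
have lts m : m < size s -> m.+1 %% size s < size s by rewrite ltn_pmod; lia.
by rewrite (mult_mkseq_diag x0 uniq_s (leqnn _) lts) // lis.
Qed.

End Walks.

Section DegreeTwo.
Variables (n : nat) (E : seq (nat * nat)).

(** The first vertex of the path meets only the second one, and only once. If the path is a single
    vertex, [w] is that vertex and no edge is counted. *)
Lemma path_pendant (K : {set 'I_n}) : K != set0 -> is_path E K ->
  exists u w : 'I_n, u \in K /\ forall v, v \in K -> mult E u v <= (v == w).
Proof.
move=> K0 /existsP[[s /= /eqP size_s] /and3P[uniq_s /eqP def_K /'forall_implyP indE]].
have memK v : (v \in K) = (v \in s) by rewrite -def_K inE.
case: s => [|x s] in size_s uniq_s def_K indE memK *.
  by case/set0Pn: K0 => v; rewrite memK.
exists x, (head x s); rewrite memK mem_head; split=> // v Kv.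
have Kx : x \in K by rewrite memK mem_head.
have /eqP -> := implyP (forallP (indE x Kx) v) Kv.
have lt_v : index v (x :: s) < size (x :: s) by rewrite index_mem -memK.
rewrite -{1 2}(nth_index x (s := x :: s) (x := v)) -?memK //.
rewrite -[X in mult _ X _]/(nth x (x :: s) 0) mult_path //.
rewrite addn0 -[head x s]/(nth x (x :: s) 1).
case: eqP => //= eq1.
by rewrite -eq1 eqxx.
Qed.

(** The successor and the predecessor of [u] are either two neighbours or one neighbour joined by a
    double edge; both violate the bound. A one-vertex cycle would be a loop, which [mult E u u = 0]
    excludes. *)
Lemma cycle_not_pendant (K : {set 'I_n}) u w : is_cycle E K -> u \in K ->
  mult E u u = 0 -> ~ (forall v, v \in K -> mult E u v <= (v == w)).
Proof.
move=> /existsP[[s /= /eqP size_s] /and3P[uniq_s /eqP def_K /'forall_implyP indE]].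
move=> Ku muu pend; have memK v : (v \in K) = (v \in s) by rewrite -def_K inE.
have multE v : v \in K -> mult E u v = mult (zip s (rot 1 s)) u v.
  by move=> Kv; apply/eqP; apply: (implyP (forallP (indE u Ku) v) Kv).
pose k := size s; pose i := index u s.
have lik : i < k by rewrite index_mem -memK.
have uE : u = nth u s i by rewrite nth_index -?memK.
have k0 : 0 < k by lia.
pose j := i.+1 %% k; pose p := (i + k.-1) %% k.
have ljk : j < k by rewrite ltn_pmod.
have lpk : p < k by rewrite ltn_pmod.
have jE : j = if i.+1 == k then 0 else i.+1.
  by rewrite /j; case: eqP => [->|]; rewrite ?modnn // => ?; rewrite modn_small //; lia.
have pE : p = if i == 0 then k.-1 else i.-1.
  rewrite /p; case: eqP => [->|i0]; first by rewrite modn_small // add0n; lia.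
  by rewrite (_ : i + k.-1 = i.-1 + k) ?modnDr ?modn_small //; lia.
have pS : p.+1 %% k = i.
  rewrite pE; case: eqP => [->|?]; first by rewrite prednK ?modnn.
  by rewrite prednK ?modn_small //; lia.
have memn m : m < k -> nth u s m \in K by move=> ?; rewrite memK mem_nth.
have mult_nth m : m < k -> i != m ->
    mult E u (nth u s m) = (j == m) + (m.+1 %% k == i).
  by move=> lm nim; rewrite multE ?memn // {1}uE mult_cycle.
have [eq_ij|neq_ij] := eqVneq i j.
  by move: muu; rewrite multE // {1 2}uE mult_cycle_diag // -/k -/j -eq_ij eqxx.
have neq_ip : i != p.
  by move: neq_ij; rewrite jE pE; case: (i.+1 =P k) => ?; case: (i =P 0) => ?; lia.
have := pend _ (memn j ljk); have := pend _ (memn p lpk).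
rewrite !mult_nth // pS !eqxx addn1.
case: (eqVneq (nth u s p) w) => [pw _|_]; last by case: (j == p).
case: (eqVneq (nth u s j) w) => [jw|]; last by [].
have /eqP : nth u s j = nth u s p by rewrite pw jw.
rewrite nth_uniq // => /eqP eq_jp.
by rewrite eq_jp pS eqxx.
Qed.

End DegreeTwo.

Section EnumeratedComponent.
Variables (n : nat) (E : seq (nat * nat)) (K : {set 'I_n}).
Variables (m : nat) (x : nat -> 'I_n).
Hypothesis x_inj : forall i j, i < m -> j < m -> (x i == x j) = (i == j).
Hypothesis memK : forall i, i < m -> x i \in K.
Hypothesis cardK : #|K| <= m.

Let xs := mkseq x m.

Let uniq_xs : uniq xs.
Proof.
rewrite map_inj_in_uniq ?iota_uniq // => i j; rewrite !mem_iota /= => li lj.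
by move/eqP; rewrite x_inj // => /eqP.
Qed.

(** [m] distinct points of a set of at most [m] elements exhaust it, so later only an upper bound on
    [#|K|] has to be supplied. *)
Let def_K : [set:: xs] = K.
Proof.
apply/eqP; rewrite eqEcard cardsE (card_uniqP uniq_xs) size_mkseq cardK andbT.
apply/subsetP => v; rewrite inE => /mapP[i]; rewrite mem_iota /= => li ->.
exact: memK.
Qed.

Let tuple_of_xs : size xs == #|K|.
Proof. by rewrite -def_K cardsE (card_uniqP uniq_xs). Qed.

Let induced_xs F :
  (forall i j, i < m -> j < m -> mult E (x i) (x j) = mult F (x i) (x j)) ->
  induced_edges E K F.
Proof.
move=> multE; apply/'forall_implyP => u; rewrite -def_K inE => /mapP[i].
rewrite mem_iota /= => li ->; apply/'forall_implyP => v.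
by rewrite inE => /mapP[j]; rewrite mem_iota /= => lj ->; rewrite multE.
Qed.

Lemma is_path_enum :
  (forall i j, i < m -> j < m ->
     mult E (x i) (x j) = (i.+1 == j) + (j.+1 == i)) -> is_path E K.
Proof.
move=> multE; apply/existsP; exists (Tuple tuple_of_xs).
rewrite /= uniq_xs def_K eqxx /=; apply: induced_xs => i j li lj.
have nthx l : l < m -> x l = nth (x 0) xs l by move=> ?; rewrite nth_mkseq.
by rewrite multE // (nthx i) // (nthx j) // mult_path ?size_mkseq.
Qed.

Lemma is_cycle_enum : 1 < m ->
  (forall i, i < m -> mult E (x i) (x i) = 0) ->
  (forall i j, i < m -> j < m -> i != j ->
     mult E (x i) (x j) = (i.+1 %% m == j) + (j.+1 %% m == i)) -> is_cycle E K.
Proof.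
move=> m1 mult0 multE; apply/existsP; exists (Tuple tuple_of_xs).
rewrite /= uniq_xs def_K eqxx /=; apply: induced_xs => i j li lj.
have nthx l : l < m -> x l = nth (x 0) xs l by move=> ?; rewrite nth_mkseq.
have [<-|neq_ij] := eqVneq i j.
  rewrite mult0 // nthx // mult_cycle_diag ?size_mkseq //.
  have [eq_im|neq_im] := eqVneq i.+1 m; first by rewrite eq_im modnn; lia.
  by rewrite modn_small; lia.
by rewrite multE // (nthx i) // (nthx j) // mult_cycle ?size_mkseq.
Qed.

End EnumeratedComponent.

(** * Orbits of a product of two involutions *)

Section TwoInvolutions.
Variables (T : finType) (s t : {perm T}).
Hypotheses (sK : involutive s) (tK : involutive t).
Let g := (s * t)%g.

(** The dihedral relation: [s] conjugates [g] to its inverse. *)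
Lemma mul_invo_swap x : g (s (g x)) = s x.
Proof. by rewrite !permM sK tK. Qed.

Lemma iter_invo_swap i x : iter i g (s (iter i g x)) = s x.
Proof. by elim: i x => //= i IH x; rewrite -iterS iterSr mul_invo_swap IH. Qed.

Lemma mem_porbit_iter i x : iter i g x \in porbit g x.
Proof. by rewrite -permX mem_porbit. Qed.

Lemma porbit_iterP x y : y \in porbit g x ->
  exists2 i, i < #|porbit g x| & y = iter i g x.
Proof. by rewrite porbit_traject => /trajectP. Qed.

Lemma iter_porbit_inj x i j : i < #|porbit g x| -> j < #|porbit g x| ->
  (iter i g x == iter j g x) = (i == j).
Proof.
move=> li lj; rewrite -(nth_traject g li) -(nth_traject g lj).
by rewrite nth_uniq ?size_traject ?uniq_traject_porbit.
Qed.

(** If [y = g^i x], then [i] steps of [g] lead from [s y] to [s x], by the dihedral relation. Thus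
    [s] permutes the orbits. *)
Lemma porbit_left x y : y \in porbit g x -> s y \in porbit g (s x).
Proof.
case/porbit_iterP => i _ ->.
by rewrite porbit_sym -(iter_invo_swap i) mem_porbit_iter.
Qed.

Lemma porbit_right x : porbit g (t x) = porbit g (s x).
Proof.
apply/eqP; rewrite eq_porbit_mem.
by have := mem_porbit_iter 1 (s x); rewrite /= permM sK.
Qed.

Lemma porbit_leftE x y : (s y \in porbit g (s x)) = (y \in porbit g x).
Proof. by apply/idP/idP => /porbit_left; rewrite ?sK. Qed.

(** The walk from [x] to [s x = g^i x] folds at its midpoint [w], reached after [i./2] steps.
    Cancelling these steps gives [s w = w] for even [i], and [s w = g w = t (s w)] for odd [i]; then
    [s w] is the fixed point. *)
Lemma porbit_fixed x : s x \in porbit g x ->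
  exists2 w, w \in porbit g x & (s w == w) || (t w == w).
Proof.
case/porbit_iterP => i _ sxE; pose w := iter i./2 g x.
have gsw : iter i./2 g (s w) = s x by apply: iter_invo_swap.
have/(congr1 odd) := odd_double_half i; move: (odd_double_half i).
case: (odd i) => [iE _|iE _].
- exists (s w).
    have : iter i./2 g (s w) \in porbit g x by rewrite gsw sxE mem_porbit_iter.
    by rewrite -permX -eq_porbit_mem porbit_perm eq_porbit_mem.
  suff swE : s w = g w by rewrite {4}swE permM eqxx orbT.
  apply: (@perm_inj _ (g ^+ i./2)%g); rewrite !permX gsw sxE -{1}iE /w.
  by rewrite -iterSr -iterD addSn addnn add1n.
exists w; first exact: mem_porbit_iter.
suff -> : s w = w by rewrite eqxx.
apply: (@perm_inj _ (g ^+ i./2)%g); rewrite !permX gsw sxE -{1}iE /w.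
by rewrite -iterD addnn.
Qed.

End TwoInvolutions.

(** * Components of the meander as unions of orbits *)

Section ComponentShapes.
Variables (n : nat) (E : seq (nat * nat)) (s t : {perm 'I_n}).
Hypotheses (sK : involutive s) (tK : involutive t).
Hypothesis mE : forall u v : 'I_n,
  mult E u v = (u != v) * ((s u == v) + (t u == v)).
Let g := (s * t)%g.

(** Each move by [s] or [t] is an edge or stays in place, and [g] is two such moves. Conversely the
    union is closed under both: [s] exchanges the two orbits, and [t y = g (s y)] lies in the orbit
    of [s y]. *)
Lemma component_porbit u :
  [set v | connect (adj E) u v] = porbit g u :|: porbit g (s u).
Proof.
have conn_s v : connect (adj E) v (s v).
  have [<-|neq] := eqVneq v (s v); first exact: connect0.
  by rewrite connect1 // /adj mE neq eqxx.
have conn_t v : connect (adj E) v (t v).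
  have [<-|neq] := eqVneq v (t v); first exact: connect0.
  by rewrite connect1 // /adj mE neq eqxx addn1.
have conn_g i v : connect (adj E) v (iter i g v).
  elim: i => [|i IH]; first exact: connect0.
  apply: (connect_trans IH); rewrite iterS permM.
  exact: connect_trans (conn_s _) (conn_t _).
apply/eqP; rewrite eqEsubset; apply/andP; split; apply/subsetP => v; last first.
  rewrite !inE => /orP[] /porbit_iterP[i _ ->] //.
  exact: connect_trans (conn_s u) (conn_g i _).
rewrite inE => /connectP[p].
elim/last_ind: p v => [|p x IH] v /=; first by move=> _ ->; rewrite inE porbit_id.
rewrite rcons_path last_rcons => /andP[up]; set y := last u p => yx ->.
have := IH y up erefl; rewrite !inE => mem_y.
have sy : (s y \in porbit g u) || (s y \in porbit g (s u)).
  rewrite orbC (porbit_leftE sK tK); case/orP: mem_y => [->//|].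
  by move/(porbit_left sK tK); rewrite sK => ->; rewrite orbT.
have ty : (t y \in porbit g u) || (t y \in porbit g (s u)).
  move: sy; rewrite -!(eq_porbit_mem g) => sy.
  by rewrite (porbit_right t sK).
by move: yx; rewrite /adj mE; case: eqP; case: eqP => [<-|_]; case: eqP => [<-|].
Qed.

Lemma is_path_fixed u : t u = u -> is_path E (porbit g u).
Proof.
move=> tu; set k := #|porbit g u|.
have k0 : 0 < k by rewrite lt0n card_porbit_neq0.
have gs y : g (s y) = t y by rewrite permM sK.
have gk : iter k g u = u := iter_porbit g u.
(* As [t] fixes [u], [s u] is the predecessor of [u] under [g]. Hence on exponents [s] and [t] act
   as the reflections [i -> k - 1 - i] and [i -> k - i] modulo [k]. *)
have gu : iter k.-1 g u = s u.
  by apply: (@perm_inj _ g); rewrite -iterS prednK // gk gs tu.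
have s_iter i : i < k -> s (iter i g u) = iter (k.-1 - i) g u.
  move=> lik; apply: (@perm_inj _ (g ^+ i)%g); rewrite !permX.
  rewrite (iter_invo_swap sK tK) -gu -iterD; congr iter; lia.
have t_iter i : i < k -> t (iter i g u) = iter (if i == 0 then 0 else k - i) g u.
  move=> lik; rewrite -gs s_iter // -iterS.
  case: (i =P 0) => [->|i0]; first by rewrite subn0 prednK.
  by rewrite (_ : (k.-1 - i).+1 = k - i) //; lia.
(* From its end [u] the path runs through u, g^-1 u, g u, g^-2 u, g^2 u, ...,
   where g^-(i+1) u = g^(k-1-i) u. *)
pose e i := if odd i then k.-1 - i./2 else i./2.
have lt_e i : i < k -> e i < k by rewrite /e; case: ifP; lia.
have inj_iter i j : i < k -> j < k -> (iter i g u == iter j g u) = (i == j).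
  exact: iter_porbit_inj.
apply: (@is_path_enum _ _ _ k (fun i => iter (e i) g u)) => // [i j li lj|i li|i j li lj].
- by rewrite inj_iter ?lt_e // /e; case: ifP; case: ifP; lia.
- exact: mem_porbit_iter.
rewrite mE inj_iter ?lt_e // s_iter ?lt_e // t_iter ?lt_e //.
rewrite !inj_iter ?lt_e //; last 2 first.
- by have := lt_e i li; case: ifP; lia.
- by have := lt_e i li; lia.
have [->|/eqP neq_ij] := eqVneq i j; first by rewrite eqxx mul0n; lia.
have -> : (e i != e j) = true.
  by apply/eqP; rewrite /e; case: (boolP (odd i)); case: (boolP (odd j)); lia.
(* In path order [s] joins positions 2l and 2l+1, while [t] joins 2l+1 and 2l+2. *)
have -> : (k.-1 - e i == e j) = ((if odd i then i.-1 else i.+1) == j).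
  apply/eqP/eqP; rewrite /e;
  by case: (boolP (odd i)) => ?; case: (boolP (odd j)) => ?; lia.
have -> : ((if e i == 0 then 0 else k - e i) == e j)
    = ((if odd i then i.+1 else i.-1) == j).
  case: (e i =P 0); rewrite /e => ei; apply/eqP/eqP; move: ei;
  by case: (boolP (odd i)) => ?; case: (boolP (odd j)) => ?; lia.
rewrite mul1n; case: (boolP (odd i)) => oi; [rewrite addnC|]; congr (_ + nat_of_bool _).
  by apply/eqP/eqP; lia.
by apply/eqP/eqP; lia.
Qed.

(** The two orbits are disjoint, and the cycle reads [u], [s u], [g u], [s (g u)], and so on: [s]
    joins positions 2l and 2l+1, and [t] joins 2l+1 to 2l+2 modulo [2k], because [t (s y) = g y].
    For [k = 1] this is the double edge. *)
Lemma is_cycle_free u : s u \notin porbit g u ->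
  is_cycle E (porbit g u :|: porbit g (s u)).
Proof.
move=> su; set k := #|porbit g u|.
have k0 : 0 < k by rewrite lt0n card_porbit_neq0.
have gk : iter k g u = u := iter_porbit g u.
pose x i := if odd i then s (iter i./2 g u) else iter i./2 g u.
have inj_iter i j : i < k -> j < k -> (iter i g u == iter j g u) = (i == j).
  exact: iter_porbit_inj.
have disj i j : s (iter i g u) != iter j g u.
  apply: contra su => /eqP eq_sg.
  have := porbit_left sK tK (mem_porbit_iter s t i u).
  rewrite eq_sg -!(eq_porbit_mem g) => /eqP <-.
  by rewrite eq_porbit_mem mem_porbit_iter.
have x_inj i j : i < k.*2 -> j < k.*2 -> (x i == x j) = (i == j).
  rewrite /x => li lj; case: ifP => oi; case: ifP => oj.
  - by rewrite (inj_eq perm_inj) inj_iter; lia.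
  - by rewrite (negPf (disj _ _)); lia.
  - by rewrite eq_sym (negPf (disj _ _)); lia.
  - by rewrite inj_iter; lia.
have s_x i : s (x i) = x (if odd i then i.-1 else i.+1).
  rewrite /x; case: (boolP (odd i)) => oi.
    by rewrite sK ifF; [congr iter | ]; lia.
  by rewrite ifT; [congr (s (iter _ _ _)) | ]; lia.
have t_x i : i < k.*2 -> t (x i) = x (if odd i then i.+1 %% k.*2
                                     else if i == 0 then k.*2.-1 else i.-1).
  move=> li; rewrite /x; case: (boolP (odd i)) => oi.
    have -> : t (s (iter i./2 g u)) = iter i./2.+1 g u by rewrite iterS permM.
    have [eq_ik|neq_ik] := eqVneq i.+1 k.*2.
      have -> : i./2.+1 = k by lia.
      by rewrite eq_ik modnn gk.
    have lt_i : i.+1 < k.*2 by lia.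
    have -> : i./2.+1 = i.+1./2 by lia.
    by rewrite modn_small // ifF //; lia.
  have ts i' : t (iter i'.+1 g u) = s (iter i' g u) by rewrite iterS permM tK.
  have [->|i0] := eqVneq i 0.
    rewrite ifT; last by lia.
    rewrite -{1}gk /= -{1}(prednK k0) ts; congr (s (iter _ _ _)); lia.
  rewrite ifT; last by lia.
  by rewrite -ts; congr (t (iter _ _ _)); lia.
apply: (@is_cycle_enum _ _ _ k.*2 x) => //.
- move=> i li; rewrite /x inE; case: ifP => _.
    by rewrite orbC (porbit_left sK tK) // mem_porbit_iter.
  by rewrite mem_porbit_iter.
- rewrite (leq_trans (leq_card_setU _ _)) // -addnn leq_add2l.
  have -> : porbit g (s u) = s @: porbit g u.
    apply/setP => y; apply/idP/imsetP => [gy|[z gz ->]].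
      by exists (s y); rewrite ?sK // -(porbit_leftE sK tK) sK.
    exact: (porbit_left sK tK).
  exact: leq_imset_card.
- lia.
- by move=> i _; rewrite mE eqxx.
have modE l : l < k.*2 -> l.+1 %% k.*2 = if l.+1 == k.*2 then 0 else l.+1.
  by case: (l.+1 =P k.*2) => [->|?]; rewrite ?modnn // => ?; rewrite modn_small; lia.
move=> i j li lj neq_ij; rewrite mE s_x t_x // !x_inj //; last 2 first.
- rewrite modE //; case: (boolP (odd i)) => ?; case: (i =P 0) => ?;
    by case: (i.+1 =P k.*2) => ?; lia.
- by case: (boolP (odd i)) => ?; lia.
rewrite !modE // neq_ij mul1n.
case: (boolP (odd i)) => oi /=; case: (i.+1 =P k.*2) => ? /=;
  case: (j.+1 =P k.*2) => ? /=; case: (i =P 0) => ? /=; lia.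
Qed.

End ComponentShapes.

Section ComponentOrbits.
Variables (n : nat) (E : seq (nat * nat)) (s t : {perm 'I_n}).
Hypotheses (sK : involutive s) (tK : involutive t).
Hypothesis mE : forall u v : 'I_n,
  mult E u v = (u != v) * ((s u == v) + (t u == v)).
Let g := (s * t)%g.

(** The orbit contains a fixed point of [s] or of [t], which is an end of the path and cannot lie on
    a cycle. The case of [s] reduces to that of [t] by exchanging the involutions, since [t * s] is
    the inverse of [g] and has the same orbits. *)
Lemma component_path u : s u \in porbit g u ->
  is_path E (porbit g u) && ~~ is_cycle E (porbit g u).
Proof.
move=> su; have [w uw fix_w] := porbit_fixed sK tK su.
have eq_wu : porbit g w = porbit g u by apply/eqP; rewrite eq_porbit_mem.
apply/andP; split; last first.
  have ww : mult E w w = 0 by rewrite mE eqxx.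
  case/orP: fix_w => /eqP fix_w; apply/negP.
    move=> cyc; apply: (@cycle_not_pendant _ _ _ _ (t w) cyc uw ww) => v _.
    by rewrite mE fix_w (eq_sym v); case: eqVneq; rewrite ?mul1n.
  move=> cyc; apply: (@cycle_not_pendant _ _ _ _ (s w) cyc uw ww) => v _.
  by rewrite mE fix_w (eq_sym v); case: eqVneq; rewrite ?mul1n ?addn0.
case/orP: fix_w => /eqP fix_w; rewrite -eq_wu.
  have gV : (t * s)%g = (g^-1)%g.
    apply/permP => y; apply: (@perm_inj _ g).
    by rewrite permKV !permM sK tK.
  have mE' (x v : 'I_n) : mult E x v = (x != v) * ((t x == v) + (s x == v)).
    by rewrite mE addnC.
  by have := is_path_fixed tK sK mE' fix_w; rewrite gV porbitV.
exact: (is_path_fixed sK tK mE fix_w).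
Qed.

(** For every [y] in [K], both [s y] and [t y] lie in the orbit other than that of [y], so neither
    involution fixes a point of [K]. Every vertex then has degree two and none can be the end of a
    path. *)
Lemma component_cycle u : s u \notin porbit g u ->
  is_cycle E (porbit g u :|: porbit g (s u))
  && ~~ is_path E (porbit g u :|: porbit g (s u)).
Proof.
move=> su; rewrite (is_cycle_free sK tK mE su) /=; set K := _ :|: _; apply/negP => pathK.
have K0 : K != set0 by apply/set0Pn; exists u; rewrite inE porbit_id.
have [x [w [Kx pend]]] := path_pendant K0 pathK.
have orbits y : y \in K ->
    [/\ s y \in K, t y \in K & porbit g y != porbit g (s y)].
  move=> Ky; have neq_u : porbit g u != porbit g (s u).
    by rewrite eq_sym eq_porbit_mem.
  have : (porbit g y == porbit g u) && (porbit g (s y) == porbit g (s u))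
      || (porbit g y == porbit g (s u)) && (porbit g (s y) == porbit g u).
    rewrite !eq_porbit_mem (porbit_leftE sK tK).
    move: Ky; rewrite inE => /orP[-> //|yu]; rewrite yu.
    by move/(porbit_left sK tK): yu; rewrite sK => ->; rewrite orbT.
  rewrite !inE -!(eq_porbit_mem g) (porbit_right t sK).
  by case/orP => /andP[/eqP-> /eqP->]; rewrite eqxx ?orbT //= eq_sym.
have moved y : y \in K -> s y != y /\ t y != y.
  move=> /orbits[_ _ neq]; split; apply: contra neq => /eqP yE.
    by rewrite yE.
  by rewrite -(porbit_right t sK) yE.
have [Ksx Ktx _] := orbits _ Kx; have [sx tx] := moved _ Kx.
have := pend _ Ksx; have := pend _ Ktx; rewrite !mE !eqxx.
rewrite !(eq_sym x) tx sx !mul1n.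
have [<-|_] := eqVneq (t x) w; last by case: (s x == t x).
by rewrite (eq_sym (t x)); case: (s x == t x).
Qed.

(** Orbits are sorted by the component [h O] that contains them. A component holds one orbit if it
    is a path and two if it is a cycle, and it is never counted as both. *)
Lemma index_porbits : 2 * num_cycles n E + num_paths n E = #|porbits g|.
Proof.
pose h (O : {set 'I_n}) := O :|: s @: O.
have s_porbit u : s @: porbit g u = porbit g (s u).
  apply/setP => y; apply/imsetP/idP => [[z gz ->]|gy].
    exact: (porbit_left sK tK).
  by exists (s y); rewrite ?sK // -(porbit_leftE sK tK) sK.
have hE u : h (porbit g u) = [set v | connect (adj E) u v].
  by rewrite (component_porbit sK tK mE) /h s_porbit.
have sumE (p : pred {set 'I_n}) :
    #|[set K in components n E | p K]| = \sum_(K in components n E) p K.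
  rewrite -sum1_card big_mkcond [RHS]big_mkcond; apply: eq_bigr => K _.
  by rewrite inE; case: (_ \in _); case: (p K).
rewrite /num_cycles /num_paths !sumE big_distrr -big_split /=.
rewrite -[RHS]sum1_card [RHS](partition_big h (mem (components n E))) /=; last first.
  by move=> O /imsetP[u _ ->]; rewrite hE; apply: imset_f.
apply: eq_bigr => K /imsetP[u _ ->]; rewrite -hE.
have fiber O : (O \in porbits g) && (h O == h (porbit g u))
    = (O \in [set porbit g u; porbit g (s u)]).
  apply/andP/set2P => [[/imsetP[v _ ->] /eqP eq_h]|[] ->].
  - have : v \in h (porbit g u) by rewrite -eq_h inE porbit_id.
    rewrite /h s_porbit inE -!(eq_porbit_mem g).
    by case/orP => /eqP ->; [left | right].
  - by rewrite imset_f.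
  - by rewrite imset_f // /h !s_porbit sK setUC eqxx.
rewrite (eq_bigl _ _ fiber) sum1_card cards2 /h s_porbit.
have [su|su] := boolP (s u \in porbit g u).
  move: (su); rewrite -(eq_porbit_mem g) => /eqP ->; rewrite setUid eqxx.
  by have /andP[-> /negPf->] := component_path su.
rewrite eq_sym eq_porbit_mem su.
by have /andP[-> /negPf->] := component_cycle su.
Qed.

End ComponentOrbits.

(** * Block reflections *)

Lemma multC (T : eqType) (E : seq (T * T)) u v : mult E u v = mult E v u.
Proof. by apply: eq_count => e; rewrite orbC. Qed.

Lemma mult_cat (T : eqType) (E F : seq (T * T)) u v :
  mult (E ++ F) u v = mult E u v + mult F u v.
Proof. exact: count_cat. Qed.

(* The centre of a block of odd size is its own partner. *)
Fixpoint partner (p : nat) (a : seq nat) (v : nat) : nat :=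
  if a is x :: a' then
    if v < p + x then p + (p + x).-1 - v else partner (p + x) a' v
  else v.

Lemma partner_bounds p a v : p <= v < p + sumn a ->
  p <= partner p a v < p + sumn a.
Proof.
elim: a p => [|x a IH] p /=; first by lia.
by case: (ltnP v (p + x)) => vx Hv; [|have := IH (p + x)]; lia.
Qed.

Lemma partnerK p a v : p <= v < p + sumn a -> partner p a (partner p a v) = v.
Proof.
elim: a p => [|x a IH] p //= Hv.
case: (ltnP v (p + x)) => vx; first by rewrite ifT; lia.
have Hv' : p + x <= v < p + x + sumn a by lia.
by rewrite ifF ?IH //; have := partner_bounds Hv'; lia.
Qed.

Lemma mult_block_edges_lt p a u v : u < p -> mult (block_edges p a) u v = 0.
Proof.
elim: a p => [|x a IH] p //= lt_up; rewrite mult_cat IH ?addn0; last by lia.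
rewrite /mult count_map count_filter (eq_in_count (a2 := pred0)) ?count_pred0 //.
move=> i _ /=; rewrite !xpair_eqE; move: lt_up; clear; lia.
Qed.

Lemma mult_one_block p x u v : p <= u -> p <= v ->
  mult [seq (p + i, (p + x).-1 - i) | i <- iota 0 x & p + i < (p + x).-1 - i] u v
  = [&& u != v, u < p + x, v < p + x & u + v == p + (p + x).-1].
Proof.
move=> pu pv; rewrite /mult count_map count_filter.
(* An edge is generated from its left end, so only the index [minn u v - p] can contribute. *)
rewrite (eq_in_count (a2 := fun i => (i == minn u v - p) &&
   [&& u != v, u < p + x, v < p + x & u + v == p + (p + x).-1])); last first.
  move=> i; rewrite mem_iota /= !xpair_eqE; move: pu pv; clear; lia.
set b := [&& _, _, _ & _]; case: (boolP b) => [|_]; last first.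
  by rewrite (eq_count (a2 := pred0)) ?count_pred0 // => i; rewrite andbF.
rewrite (eq_count (a2 := pred1 (minn u v - p))) => [Hb|i]; last by rewrite andbT.
rewrite count_uniq_mem ?iota_uniq // mem_iota; move: Hb pu pv; rewrite /b; clear; lia.
Qed.

Lemma mult_block_edges p a u v : p <= u -> p <= v ->
  mult (block_edges p a) u v = (u != v) && (partner p a u == v).
Proof.
elim: a p => [|x a IH] p pu pv /=; first by case: eqVneq.
rewrite mult_cat mult_one_block //.
have [ux|xu] := ltnP u (p + x); first by rewrite mult_block_edges_lt //; lia.
have [vx|xv] := ltnP v (p + x); last by rewrite andbF /= IH.
(* Here [v] lies in the current block and [u] beyond it; the partner of [u] stays beyond it too. *)
rewrite multC mult_block_edges_lt // andbF /=.
suff : partner (p + x) a u >= p + x by lia.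
elim: a (p + x) xu {IH vx} => //= y a IH q qu.
by case: (ltnP u (q + y)) => uy; [|have := IH _ uy]; lia.
Qed.

Lemma partner_perm n a : sumn a = n ->
  exists2 s : {perm 'I_n}, involutive s & forall v : 'I_n, s v = partner 0 a v :> nat.
Proof.
move=> sum_a; have bounds (v : 'I_n) : 0 <= v < 0 + sumn a by rewrite sum_a ltn_ord.
have lt_p (v : 'I_n) : partner 0 a v < n.
  by rewrite -[X in _ < X]sum_a; case/andP: (partner_bounds (bounds v)).
pose f v := Ordinal (lt_p v).
have fK : involutive f by move=> v; apply: val_inj; rewrite /= partnerK.
by exists (perm (can_inj fK)) => v; rewrite !permE ?fK.
Qed.

Lemma mult_meander_edges n a b (s t : {perm 'I_n}) :
  (forall v : 'I_n, s v = partner 0 a v :> nat) ->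
  (forall v : 'I_n, t v = partner 0 b v :> nat) ->
  forall u v : 'I_n,
    mult (meander_edges a b) u v = (u != v) * ((s u == v) + (t u == v)).
Proof.
move=> sE tE u v; rewrite mult_cat !mult_block_edges //.
rewrite -(sE u) -(tE u) !(inj_eq val_inj).
by case: eqVneq; rewrite /= ?mul0n ?mul1n.
Qed.

(** * Executions on a memory split into registers and heap *)

(** Registers form a function, so configurations are compared pointwise and functional
    extensionality is avoided. *)
Definition eqc (s s' : config) : Prop :=
  [/\ pc s = pc s', input s = input s' & reg s =1 reg s'].

Lemma step_eqc P s s' : eqc s s' -> eqc (step P s) (step P s').
Proof.
case: s s' => [l r x] [l' r' x'] [/= <- <- eq_r]; rewrite /step /=.
have {}eq_r : r =1 r' by [].
case: (onth P l) => [c|]; last by split.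
by case: c => [i m|i j k|i j k|i j|i j|j m|i]; split=> /=; rewrite ?eq_r // => d;
  rewrite /set_reg !eq_r.
Qed.

(** The time [t] is only an upper bound, so that branches of different length share one budget. The
    bound [W] is required at every intermediate configuration, both ends included. *)
Definition reaches (P : program) (W t : nat) (s s' : config) : Prop :=
  exists2 u, u <= t & eqc (iter u (step P) s) s'
    /\ forall v, v <= u -> forall i, reg (iter v (step P) s) i < W.

Lemma reaches_leq P W t t' s s' : t <= t' ->
  reaches P W t s s' -> reaches P W t' s s'.
Proof. by move=> tt' [u ut H]; exists u => //; apply: leq_trans tt'. Qed.

Lemma iter_step_eqc P u s s' : eqc s s' ->
  eqc (iter u (step P) s) (iter u (step P) s').
Proof. by elim: u => //= u IH /IH; apply: step_eqc. Qed.

Lemma reaches_trans P W t1 t2 s1 s2 s3 :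
  reaches P W t1 s1 s2 -> reaches P W t2 s2 s3 -> reaches P W (t1 + t2) s1 s3.
Proof.
move=> [u1 le1 [eq1 bd1]] [u2 le2 [eq2 bd2]].
have eq_iter v : eqc (iter (v + u1) (step P) s1) (iter v (step P) s2).
  by rewrite iterD; apply: iter_step_eqc.
exists (u2 + u1); first by rewrite addnC leq_add.
split=> [|v le_v i].
  have [p1 i1 r1] := eq_iter u2; have [p2 i2 r2] := eq2.
  by split=> [||i]; rewrite ?p1 ?i1 ?r1.
have [le_vu1|lt_u1v] := leqP v u1; first exact: bd1.
rewrite -(subnK (ltnW lt_u1v)); have [_ _ ->] := eq_iter (v - u1).
by apply: bd2; lia.
Qed.

Lemma reaches_eqc P W t s1 s2 s3 :
  eqc s1 s2 -> reaches P W t s2 s3 -> reaches P W t s1 s3.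
Proof.
move=> eq12 [u le_ut [[p2 i2 r2] bd]]; exists u => //; split.
  have [p1 i1 r1] := iter_step_eqc P u eq12.
  by split=> [||i]; rewrite ?p1 ?i1 ?r1.
by move=> v le_vu i; have [_ _ ->] := iter_step_eqc P v eq12; apply: bd.
Qed.

(* The registers below [size l] are listed in [l], the others are read from
   [h]. *)
Definition memory (l : seq nat) (h : nat -> nat) (i : nat) : nat :=
  if i < size l then nth 0 l i else h i.

Definition state (p : nat) (l : seq nat) (h : nat -> nat) (x : seq nat) :=
  Config p (memory l h) x.

(** Symbolic execution: direct operands are entries of [l], while the indirect addresses of loads
    and stores fall into the heap. [split_ok] is the condition for this to agree with [exec]. *)
Definition exec_split (c : instr) p l h x : config :=
  match c with
  | IConst i m => state p.+1 (set_nth 0 l i m) h x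
  | IAdd i j k => state p.+1 (set_nth 0 l i (nth 0 l j + nth 0 l k)) h x
  | ISub i j k => state p.+1 (set_nth 0 l i (nth 0 l j - nth 0 l k)) h x
  | ILoad i j => state p.+1 (set_nth 0 l i (h (nth 0 l j))) h x
  | IStore i j => state p.+1 l (set_reg h (nth 0 l i) (nth 0 l j)) x
  | IJpos j m => state (if 0 < nth 0 l j then m else p.+1) l h x
  | IRead i => state p.+1 (set_nth 0 l i (head 0 x)) h (behead x)
  end.

Definition split_ok (c : instr) (l : seq nat) : bool :=
  match c with
  | IConst i _ | IRead i => i < size l
  | IAdd i j k | ISub i j k => [&& i < size l, j < size l & k < size l]
  | ILoad i j => [&& i < size l, j < size l & size l <= nth 0 l j]
  | IStore i j => [&& i < size l, j < size l & size l <= nth 0 l i]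
  | IJpos j _ => j < size l
  end.

Lemma memory_lo l h i : i < size l -> memory l h i = nth 0 l i.
Proof. by rewrite /memory => ->. Qed.

Lemma memory_hi l h i : size l <= i -> memory l h i = h i.
Proof. by rewrite /memory ltnNge => ->. Qed.

Lemma set_reg_lo l h i v : i < size l ->
  set_reg (memory l h) i v =1 memory (set_nth 0 l i v) h.
Proof.
move=> li d; rewrite /set_reg /memory size_set_nth (maxn_idPr li) nth_set_nth /=.
by case: eqP => // ->; rewrite li.
Qed.

Lemma set_reg_hi l h i v : size l <= i ->
  set_reg (memory l h) i v =1 memory l (set_reg h i v).
Proof.
by move=> li d; rewrite /set_reg /memory; case: eqP => // ->; rewrite ltnNge li.
Qed.

Lemma reaches_exec P W t p l h x c s' : 0 < t ->
  onth P p = Some c -> split_ok c l -> all (gtn W) l -> (forall i, h i < W) ->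
  reaches P W t.-1 (exec_split c p l h x) s' ->
  reaches P W t (state p l h x) s'.
Proof.
move=> t0 Pp okc bd_l bd_h H; rewrite -(prednK t0) -add1n.
(* The bound after this instruction is the bound at time 0 of the remaining run. *)
have bd1 i : reg (exec_split c p l h x) i < W.
  by case: H => u _ [_ /(_ 0 (leq0n u))].
apply: reaches_trans H; exists 1 => //.
have bd0 i : memory l h i < W.
  by rewrite /memory; case: ifP => // li; apply: (allP bd_l _ (mem_nth 0 li)).
have eq1 : eqc (step P (state p l h x)) (exec_split c p l h x).
  rewrite /step /= Pp.
  case: c okc {Pp bd1} => [i m|i j k|i j k|i j|i j|j m|i] /= => [li|||||lj|li].
  - by split=> //= d; rewrite -set_reg_lo.
  - by case/and3P=> li lj lk; split=> //= d; rewrite -set_reg_lo // !memory_lo.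
  - by case/and3P=> li lj lk; split=> //= d; rewrite -set_reg_lo // !memory_lo.
  - case/and3P=> li lj lk; split=> //= d.
    by rewrite -set_reg_lo // (memory_lo _ lj) memory_hi.
  - case/and3P=> li lj lk; split=> //= d.
    by rewrite (memory_lo _ li) (memory_lo _ lj) set_reg_hi.
  - by split=> //=; rewrite memory_lo.
  - by split=> //= d; rewrite -set_reg_lo.
split=> // v; case: v => [_ i|[_ i|//]]; first exact: bd0.
have [_ _ ->] := eq1.
exact: bd1.
Qed.

Lemma reaches_refl P W t p l h x :
  all (gtn W) l -> (forall i, h i < W) ->
  reaches P W t (state p l h x) (state p l h x).
Proof.
move=> bd_l bd_h; exists 0 => //; split=> // v; rewrite leqn0 => /eqP-> i.
rewrite /= /memory; case: ifP => // li; exact: (allP bd_l _ (mem_nth 0 li)).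
Qed.

(** * The program *)

(* Vertex [v] owns the three registers from [ptr v] on and is represented by
   the address [ptr v], so that the machine needs no multiplication. *)
Definition ptr (v : nat) : nat := 11 + 3 * v.

(** Registers 1, 2, 3 and 10 hold constants. During a pass [lo] points to the current vertex and
    [hi] to its partner, [k] counts the blocks left and [x] the vertices left in the block. The
    eleven entries end just below [ptr 0]. *)
Definition regs (cnt lo k x hi t tmp : nat) : seq nat :=
  [:: cnt; 1; 3; 11; lo; k; x; hi; t; tmp; 2].

(** Two goals remain: the bound on the heap and the rest of the execution. *)
Ltac exec_one :=
  eapply reaches_exec;
  [ lia | first [eassumption | reflexivity] | rewrite /split_ok /=; lia
  | rewrite /=; lia | | rewrite /exec_split /= ].

(** * One pass over the blocks of a side, for an arbitrary loop body *)

Section Pass.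
Variables (P : program) (W n o e : nat).
Hypothesis W_big : ptr n + 3 < W.
Hypotheses
  (P0 : onth P o = Some (IRead 5))
  (P1 : onth P o.+1 = Some (IRead 6))
  (P2 : onth P o.+2 = Some (IAdd 7 4 6))
  (P3 : onth P o.+3 = Some (IAdd 7 7 6))
  (P4 : onth P o.+4 = Some (IAdd 7 7 6))
  (P5 : onth P o.+4.+1 = Some (ISub 7 7 2))
  (E0 : onth P e = Some (IAdd 4 4 2))
  (E1 : onth P e.+1 = Some (ISub 6 6 1))
  (E2 : onth P e.+2 = Some (IJpos 6 o.+4.+1))
  (E3 : onth P e.+3 = Some (ISub 5 5 1))
  (E4 : onth P e.+4 = Some (IJpos 5 o.+1)).
Variables (f : nat -> nat) (Inv : nat -> (nat -> nat) -> Prop).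
Hypothesis Inv_bound : forall u h, Inv u h -> forall i, h i < W.
Hypothesis body : forall u k x t tmp h inp,
  u < n -> k <= n -> x <= n -> t < W -> tmp < W -> f u < n -> Inv u h ->
  exists t' tmp' h', [/\ t' < W, tmp' < W, Inv u.+1 h' &
    reaches P W 6 (state o.+4.+2 (regs 0 (ptr u) k x (ptr (f u)) t tmp) h inp)
                  (state e (regs 0 (ptr u) k x (ptr (f u)) t' tmp') h' inp)].

(** Within a block the positions of partners have the constant sum [c]. The pointer [hi] starts one
    vertex too high because each round decrements it before the body. A round costs 1 + 6 + 3
    steps. *)
Lemma pass_block c u y k t tmp h inp :
  0 < y -> u + y <= n -> k <= n -> t < W -> tmp < W -> c - u < n -> Inv u h ->
  (forall v, u <= v < u + y -> v <= c /\ f v = c - v) ->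
  exists hi' t' tmp' h',
    [/\ hi' < W, t' < W, tmp' < W, Inv (u + y) h' &
      reaches P W (10 * y)
        (state o.+4.+1 (regs 0 (ptr u) k y (ptr (c - u).+1) t tmp) h inp)
        (state e.+3 (regs 0 (ptr (u + y)) k 0 hi' t' tmp') h' inp)].
Proof.
elim: y u t tmp h => // y IH u t tmp h _ le_uy le_kn lt_t lt_tmp lt_c Iu fE.
have [le_uc fu] : u <= c /\ f u = c - u by apply: fE; lia.
have lt_un : u < n by lia.
have lt_fu : f u < n by rewrite fu.
have le_yn : y.+1 <= n by lia.
have [t1 [tmp1 [h1 [lt_t1 lt_tmp1 I1 R1]]]] :=
  body inp lt_un le_kn le_yn lt_t lt_tmp lt_fu Iu.
have start : reaches P W 7
    (state o.+4.+1 (regs 0 (ptr u) k y.+1 (ptr (c - u).+1) t tmp) h inp)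
    (state e (regs 0 (ptr u) k y.+1 (ptr (f u)) t1 tmp1) h1 inp).
  have ltW := W_big; rewrite /ptr in ltW *.
  exec_one; first exact: Inv_bound Iu.
  have -> : 11 + 3 * (c - u).+1 - 3 = ptr (f u) by rewrite /ptr fu; lia.
  exact: R1.
have finish : reaches P W 3
    (state e (regs 0 (ptr u) k y.+1 (ptr (f u)) t1 tmp1) h1 inp)
    (state (if 0 < y then o.+4.+1 else e.+3)
       (regs 0 (ptr u.+1) k y (ptr (f u)) t1 tmp1) h1 inp).
  have bd := Inv_bound I1.
  have ltW := W_big; rewrite /ptr in ltW *.
  do 3 (exec_one; first exact: bd).
  have -> : 11 + 3 * u + 3 = 11 + 3 * u.+1 by lia.
  rewrite subSS subn0; apply: reaches_refl => //; rewrite /=; lia.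
have R : reaches P W 10 _ _ := reaches_trans start finish.
have lt_hi : ptr (f u) < W by have := W_big; rewrite /ptr; lia.
have [y0|y0] := posnP y.
  exists (ptr (f u)), t1, tmp1, h1; split; rewrite ?addn1 // ?y0 ?addn1 //.
  by move: R; rewrite y0.
have fE' v : u.+1 <= v < u.+1 + y -> v <= c /\ f v = c - v by move=> ?; apply: fE; lia.
have [| | hi' [t' [tmp' [h' [? ? ? I' R']]]]] :=
  IH u.+1 t1 tmp1 h1 y0 _ le_kn lt_t1 lt_tmp1 _ I1 fE'; [lia | lia |].
exists hi', t', tmp', h'; split=> //; first by rewrite -addSnnS.
(* The next vertex is still in the block, so the truncated subtraction [c - u.+1] is exact. *)
have lt_uc : u.+1 <= c by have := fE u.+1; lia.
rewrite mulnS -addSnnS; apply: reaches_trans R'.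
rewrite y0 fu in R; rewrite (_ : (c - u.+1).+1 = c - u) //; lia.
Qed.

(** Beyond 10 steps per vertex, a block costs 4 steps to enter and 2 to leave. Blocks are nonempty,
    so these 6 steps can be charged to a vertex, which gives 16 per vertex. *)
Lemma pass_blocks (a : seq nat) u t tmp h rest :
  a != [::] -> all (fun x => 0 < x) a -> u + sumn a = n ->
  t < W -> tmp < W -> Inv u h ->
  (forall v, u <= v < n -> f v = partner u a v) ->
  forall hi x, hi < W -> x < W ->
  exists hi' t' tmp' h',
    [/\ hi' < W, t' < W, tmp' < W, Inv n h' &
      reaches P W (16 * sumn a)
        (state o.+1 (regs 0 (ptr u) (size a) x hi t tmp) h (a ++ rest))
        (state e.+4.+1 (regs 0 (ptr n) 0 0 hi' t' tmp') h' rest)].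
Proof.
elim: a u t tmp h => // x a IH u t tmp h _ /= /andP[x0 a0] sum_a lt_t lt_tmp Iu fE.
move=> hi z lt_hi lt_z.
have le_an : size a <= sumn a.
  by elim: a a0 {IH sum_a fE} => //= y a IH /andP[y0 /IH]; lia.
have fE' v : u <= v < u + x -> v <= u + (u + x).-1 /\ f v = u + (u + x).-1 - v.
  by move=> Hv; rewrite fE /= ?ifT; lia.
have [| | |hi1 [t1 [tmp1 [h1 [lt_hi1 lt_t1 lt_tmp1 I1 R1]]]]] :=
  pass_block (k := (size a).+1) (a ++ rest) x0 _ _ lt_t lt_tmp _ Iu fE'; [lia | lia | lia |].
have start : reaches P W (4 + 10 * x)
    (state o.+1 (regs 0 (ptr u) (size a).+1 z hi t tmp) h (x :: a ++ rest))
    (state e.+3 (regs 0 (ptr (u + x)) (size a).+1 0 hi1 t1 tmp1) h1 (a ++ rest)).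
  have bd := Inv_bound Iu; have ltW := W_big; rewrite /ptr in ltW *.
  do 4 (exec_one; first exact: bd).
  (* Adding the size three times to [ptr u] moves the pointer just past the last vertex of the
     block. *)
  have -> : 11 + 3 * u + x + x + x = ptr (u + (u + x).-1 - u).+1.
    by rewrite /ptr; lia.
  by apply: reaches_leq R1; lia.
have finish : reaches P W 2
    (state e.+3 (regs 0 (ptr (u + x)) (size a).+1 0 hi1 t1 tmp1) h1 (a ++ rest))
    (state (if 0 < size a then o.+1 else e.+4.+1)
      (regs 0 (ptr (u + x)) (size a) 0 hi1 t1 tmp1) h1 (a ++ rest)).
  have bd := Inv_bound I1; have ltW := W_big; rewrite /ptr in ltW *.
  do 2 (exec_one; first exact: bd).
  rewrite subSS subn0; apply: reaches_refl => //; rewrite /=; lia.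
have R := reaches_trans start finish.
have [sz0|sz0] := posnP (size a).
  exists hi1, t1, tmp1, h1; move/size0nil: sz0 R sum_a => ->; rewrite /= !addn0 => R <-.
  split=> //; apply: reaches_leq R; lia.
have fE2 v : u + x <= v < n -> f v = partner (u + x) a v.
  by move=> Hv; rewrite fE /= ?ifF //; lia.
have a_neq0 : a != [::] by case: (a) sz0.
have sum_a' : u + x + sumn a = n by lia.
have lt0W : 0 < W by lia.
have [hi' [t' [tmp' [h' [? ? ? I' R']]]]] :=
  IH (u + x) t1 tmp1 h1 a_neq0 a0 sum_a' lt_t1 lt_tmp1 I1 fE2 hi1 0 lt_hi1 lt0W.
exists hi', t', tmp', h'; split=> //; rewrite sz0 in R.
by apply: reaches_leq (reaches_trans R R'); lia.
Qed.

Lemma pass (a : seq nat) h rest :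
  a != [::] -> all (fun x => 0 < x) a -> sumn a = n -> Inv 0 h ->
  (forall v, v < n -> f v = partner 0 a v) ->
  forall k x hi t tmp, k < W -> x < W -> hi < W -> t < W -> tmp < W ->
  exists hi' t' tmp' h',
    [/\ hi' < W, t' < W, tmp' < W, Inv n h' &
      reaches P W (1 + 16 * n)
        (state o (regs 0 (ptr 0) k x hi t tmp) h (size a :: a ++ rest))
        (state e.+4.+1 (regs 0 (ptr n) 0 0 hi' t' tmp') h' rest)].
Proof.
move=> a_neq0 a0 sum_a I0 fE k x hi t tmp *.
have fE' v : 0 <= v < n -> f v = partner 0 a v by apply: fE.
have [//|//|//|//|hi' [t' [tmp' [h' [? ? ? I' R]]]]] :=
  @pass_blocks a 0 t tmp h rest a_neq0 a0 sum_a _ _ I0 fE' hi x.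
exists hi', t', tmp', h'; split=> //.
have bd := Inv_bound I0; have ltW := W_big; rewrite /ptr in ltW *.
exec_one; first exact: bd.
by rewrite sum_a in R; apply: reaches_leq R; lia.
Qed.

End Pass.

(** Address [o + 5] starts the loop over the vertices of a block, [o + 1] the loop over the
    blocks. *)
Definition pass_code (o : nat) (body : program) : program :=
  [:: IRead 5; IRead 6; IAdd 7 4 6; IAdd 7 7 6; IAdd 7 7 6; ISub 7 7 2]
  ++ body
  ++ [:: IAdd 4 4 2; ISub 6 6 1; IJpos 6 (o + 5); ISub 5 5 1; IJpos 5 (o + 1)].

(** The top pass starts at 5, the bottom pass at 18 and the counting loop at 34. The test at 44
    skips the increment when the image of the current vertex lies to its left; as no image lies to
    its right, exactly the fixed points are counted. *)
Definition index_program : program :=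
  [:: IConst 1 1; IConst 2 3; IConst 10 2; IConst 3 11; IConst 4 11]
  ++ pass_code 5 [:: IStore 4 7]
  ++ [:: IConst 4 11]
  ++ pass_code 18
       [:: ILoad 8 4; IAdd 9 8 1; IStore 9 7; IAdd 9 7 10; IStore 9 8]
  ++ [:: ISub 4 4 2; IAdd 9 4 1; ILoad 7 9; IAdd 9 4 10; ILoad 8 9;
         IAdd 9 8 1; IStore 9 7; IAdd 9 7 10; IStore 9 8;
         ISub 9 4 7; IJpos 9 46; IAdd 0 0 1; ISub 9 4 3; IJpos 9 34;
         ISub 0 0 1].

Lemma set_reg_bound W h i v : (forall j, h j < W) -> v < W ->
  forall j, set_reg h i v j < W.
Proof. by move=> bd lt_v j; rewrite /set_reg; case: eqP. Qed.

Lemma set_reg_eq h i v : set_reg h i v i = v.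
Proof. by rewrite /set_reg eqxx. Qed.

Lemma set_reg_neq h i v j : j != i -> set_reg h i v j = h j.
Proof. by rewrite /set_reg => /negPf->. Qed.

(** * Storing the permutation and its inverse *)

Section Passes.
Variables (W n : nat) (fa fb : nat -> nat).
Hypothesis W_big : ptr n + 3 < W.
Hypothesis lt_fa : forall v, v < n -> fa v < n.
Hypothesis lt_fb : forall v, v < n -> fb v < n.
Hypothesis faK : forall v, v < n -> fa (fa v) = v.
Hypothesis fbK : forall v, v < n -> fb (fb v) = v.

Definition top_done (u : nat) (h : nat -> nat) : Prop :=
  (forall i, h i < W) /\ forall v, v < u -> h (ptr v) = ptr (fa v).

Lemma top_body u k x t tmp h inp :
  u < n -> k <= n -> x <= n -> t < W -> tmp < W -> fa u < n -> top_done u h ->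
  exists t' tmp' h', [/\ t' < W, tmp' < W, top_done u.+1 h' &
    reaches index_program W 6
      (state 11 (regs 0 (ptr u) k x (ptr (fa u)) t tmp) h inp)
      (state 12 (regs 0 (ptr u) k x (ptr (fa u)) t' tmp') h' inp)].
Proof.
move=> lt_un le_kn le_xn lt_t lt_tmp lt_f [bd hE].
exists t, tmp, (set_reg h (ptr u) (ptr (fa u))).
have ltW := W_big; rewrite /ptr in ltW *.
have bd' : forall j, set_reg h (11 + 3 * u) (11 + 3 * fa u) j < W.
  by apply: set_reg_bound => //; lia.
split=> //.
  split=> // v lt_v; rewrite /ptr /set_reg; case: eqP => [eq_uv|neq_uv].
    by have -> : v = u by lia.
  by apply: hE; lia.
exec_one; first exact: bd.
by apply: reaches_refl => //; rewrite /=; lia.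
Qed.

(* [fb \o fa] and its inverse are stored at the offsets 1 and 2. *)
Definition bottom_done (u : nat) (h : nat -> nat) : Prop :=
  [/\ forall i, h i < W, forall v, v < n -> h (ptr v) = ptr (fa v) &
      forall v, v < u ->
        h (ptr (fa v)).+1 = ptr (fb v) /\ h (ptr (fb v)).+2 = ptr (fa v)].

(** The product maps [fa u] to [fb (fa (fa u)) = fb u], so the visit to [u] fills the entry of
    [fa u] in one array and that of [fb u] in the other. Involutions are injective, so earlier
    entries survive. *)
Lemma bottom_body u k x t tmp h inp :
  u < n -> k <= n -> x <= n -> t < W -> tmp < W -> fb u < n ->
  bottom_done u h ->
  exists t' tmp' h', [/\ t' < W, tmp' < W, bottom_done u.+1 h' &
    reaches index_program W 6
      (state 24 (regs 0 (ptr u) k x (ptr (fb u)) t tmp) h inp)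
      (state 29 (regs 0 (ptr u) k x (ptr (fb u)) t' tmp') h' inp)].
Proof.
move=> lt_un le_kn le_xn lt_t lt_tmp lt_f [bd hE hE'].
pose h1 := set_reg h (ptr (fa u)).+1 (ptr (fb u)).
pose h2 := set_reg h1 (ptr (fb u)).+2 (ptr (fa u)).
exists (ptr (fa u)), (ptr (fb u)).+2, h2.
have lt_fau := lt_fa lt_un.
have bd1 j : h1 j < W by apply: set_reg_bound => //; have := W_big; rewrite /ptr; lia.
have bd2 j : h2 j < W by apply: set_reg_bound => //; have := W_big; rewrite /ptr; lia.
have ltW := W_big.
split=> //; try by rewrite /ptr in ltW *; lia.
  split=> // v lt_v.
    (* Writes at offsets 1 and 2 never hit offset 0, as addresses of vertices are 3 apart. *)
    by rewrite /h2 /h1 !set_reg_neq ?hE // /ptr; clear; lia.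
  have [->|neq_uv] := eqVneq v u.
    rewrite /h2 set_reg_eq set_reg_neq ?/h1 ?set_reg_eq // /ptr; clear; lia.
  have lt_vu : v < u by lia.
  have lt_vn : v < n by lia.
  have [hF hG] := hE' _ lt_vu.
  have neq_fa : fa v <> fa u.
    by move/(congr1 fa); rewrite !faK //; lia.
  have neq_fb : fb v <> fb u.
    by move/(congr1 fb); rewrite !fbK //; lia.
  split; rewrite /h2 /h1 !set_reg_neq //; move: neq_fa neq_fb; rewrite /ptr; clear; lia.
have := hE _ lt_un; rewrite /ptr in ltW * => hu.
exec_one; first exact: bd.
rewrite hu.
do 2 (exec_one; first exact: bd).
rewrite addn1 -/h1.
do 2 (exec_one; first exact: bd1).
rewrite addn2 -/h2.
by apply: reaches_refl => //; rewrite /=; lia.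
Qed.

End Passes.

(** * Removing a point from its cycle *)

Section Bypass.
Variables (T : finType) (r : {perm T}) (v : T).

(** This is deletion from a doubly linked list, written with a transposition so that its effect on
    the number of orbits is known. *)
Definition bypass : {perm T} := (tperm (r^-1 v)%g v * r)%g.

Lemma bypassE w :
  bypass w = if w == v then v else if w == (r^-1 v)%g then r v else r w.
Proof.
rewrite /bypass permM; have [->|nwv] := eqVneq w v; first by rewrite tpermR permKV.
have [->|nwr] := eqVneq w (r^-1 v)%g; first by rewrite tpermL.
by rewrite tpermD // eq_sym.
Qed.

Lemma bypassVE w :
  (bypass^-1 w)%g = if w == v then v else if w == r v then (r^-1 v)%g
                    else (r^-1 w)%g.
Proof.
apply: (@perm_inj _ bypass); rewrite permKV bypassE.
have [->|nwv] := eqVneq w v; first by rewrite eqxx.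
have [->|nwr] := eqVneq w (r v).
  rewrite eqxx; case: eqVneq => // rv.
  by move: nwv; rewrite -{2}rv permKV => /eqP.
have -> : (r^-1 w == v)%g = false.
  by apply/eqP => rw; move: nwr; rewrite -rw permKV eqxx.
by rewrite (inj_eq perm_inj) (negPf nwv) permKV.
Qed.

(** [v] and its predecessor share an orbit, so the transposition splits that orbit, unless they
    coincide and it is trivial. *)
Lemma card_porbits_bypass : #|porbits bypass| = #|porbits r| + (r v != v).
Proof.
have := porbits_mul_tperm r (r^-1 v)%g v; rewrite -/bypass.
have -> : (r^-1 v)%g \in porbit r v by rewrite -porbitV (mem_porbit _ 1).
rewrite /= double0 addn0 => ->; congr (_ + ~~ _).
by rewrite -(inj_eq (@perm_inj _ r)) permKV eq_sym.
Qed.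

End Bypass.

Lemma card_porbits1 (T : finType) : #|porbits (1 : {perm T})%g| = #|T|.
Proof.
rewrite card_imset // => x y eq_xy; have := porbit_id 1%g x; rewrite eq_xy.
by case/porbitP => i ->; rewrite expg1n perm1.
Qed.

(** * The counting loop *)

Section Count.
Variables (W n : nat).
Hypothesis W_big : ptr n + 3 < W.

(** Only vertices below [u] are described by the heap; the entries of bypassed ones may be stale. *)
Definition remaining (u : nat) (r : {perm 'I_n}) (h : nat -> nat) : Prop :=
  [/\ forall i, h i < W, forall v : 'I_n, u <= v -> r v = v &
      forall v : 'I_n, v < u ->
        h (ptr v).+1 = ptr (r v) /\ h (ptr v).+2 = ptr (r^-1 v)%g].

(* The [n - u] vertices already bypassed are fixed points of [r], hence orbits
   that must not be counted again. *)
Lemma count_loop u r h cnt hi t tmp inp :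
  0 < u <= n -> remaining u r h -> cnt + u <= n -> 
  hi < W -> t < W -> tmp < W ->
  exists cnt' hi' t' h',
    [/\ cnt' + n = cnt + u + #|porbits r|, hi' < W, t' < W,
        forall i, h' i < W &
    reaches index_program W (14 * u)
      (state 34 (regs cnt (ptr u) 0 0 hi t tmp) h inp)
      (state 48 (regs cnt' 11 0 0 hi' t' 0) h' inp)].
Proof.
elim: u r h cnt hi t tmp => // u IH r h cnt hi t tmp lt_un [bd fix_r hE] le_cnt.
move=> lt_hi lt_t lt_tmp.
have lt_un' : u < n by lia.
pose v := Ordinal lt_un'.
have [hF hG] : h (ptr u).+1 = ptr (r v) /\ h (ptr u).+2 = ptr (r^-1 v)%g.
  exact: hE v (ltnSn u).
(* All vertices above [u] are fixed and [r] is injective. Hence a zero difference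
   [ptr u - ptr (r v)] means exactly [r v = v]. *)
have le_rv : r v <= u.
  have [//|lt_u] := leqP (r v) u.
  have /perm_inj eq_rv := fix_r _ lt_u.
  by move: lt_u; rewrite eq_rv ltnn.
pose h1 := set_reg h (ptr (r^-1 v)%g).+1 (ptr (r v)).
pose h2 := set_reg h1 (ptr (r v)).+2 (ptr (r^-1 v)%g).
have lt_rn := ltn_ord (r v); have lt_rVn := ltn_ord (r^-1 v)%g.
have bd1 j : h1 j < W by apply: set_reg_bound => //; have := W_big; rewrite /ptr; lia.
have bd2 j : h2 j < W by apply: set_reg_bound => //; have := W_big; rewrite /ptr; lia.
(* The two writes link the predecessor and the successor of [v] to each other. If [v] is fixed, they
   only touch its own entries, which are not read again. *)
have rem : remaining u (bypass r v) h2.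
  split=> // w.
    rewrite bypassE; case: eqVneq => [-> //|nwv] le_uw.
    have lt_uw : u < w.
      by rewrite ltn_neqAle le_uw andbT; apply: contra nwv => /eqP uw; apply/eqP/val_inj.
    case: eqVneq => [wr|_]; last exact: fix_r.
    by have := fix_r _ lt_uw; rewrite {1}wr permKV => vw; rewrite vw eqxx in nwv.
  move=> lt_wu; have nwv : w != v by apply: contraTneq lt_wu => ->; rewrite ltnn.
  have [wF wG] := hE w (ltnW lt_wu).
  rewrite bypassE bypassVE (negPf nwv); split.
    rewrite /h2 set_reg_neq; last by rewrite /ptr; clear; lia.
    case: eqVneq => [wE|nwr]; first by rewrite wE /h1 set_reg_eq.
    rewrite /h1 set_reg_neq // /ptr; apply: contra nwr => /eqP eq_w.
    by apply/eqP/val_inj => /=; lia.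
  case: eqVneq => [wE|nwr]; first by rewrite wE /h2 set_reg_eq.
  rewrite /h2 set_reg_neq; last first.
    rewrite /ptr; apply: contra nwr => /eqP eq_w.
    by apply/eqP/val_inj => /=; lia.
  by rewrite /h1 set_reg_neq // /ptr; clear; lia.
(* The last temporary [3 * u] is [ptr u - 11], positive exactly while vertices remain. *)
have R : reaches index_program W 14
    (state 34 (regs cnt (ptr u.+1) 0 0 hi t tmp) h inp)
    (state (if 0 < u then 34 else 48)
      (regs (cnt + (r v == v)) (ptr u) 0 0 (ptr (r v)) (ptr (r^-1 v)%g) (3 * u)) h2 inp).
  have ltW := W_big; rewrite /ptr in ltW *.
  exec_one; first exact: bd.
  have -> : 11 + 3 * u.+1 - 3 = 11 + 3 * u by lia.
  exec_one; first exact: bd.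
  rewrite addn1; exec_one; first exact: bd.
  rewrite hF /ptr; exec_one; first exact: bd.
  rewrite addn2; exec_one; first exact: bd.
  rewrite hG /ptr; exec_one; first exact: bd.
  rewrite addn1; exec_one; first exact: bd.
  rewrite -/h1; exec_one; first exact: bd1.
  rewrite addn2; exec_one; first exact: bd1.
  rewrite -/h2.
  exec_one; first exact: bd2.
  have [eq_rv|neq_rv] := eqVneq (r v) v.
    rewrite eq_rv /=.
    have -> : 11 + 3 * u - (11 + 3 * u) = 0 by lia.
    do 2 (exec_one; first exact: bd2).
    exec_one; first exact: bd2.
    have -> : 11 + 3 * u - 11 = 3 * u by lia.
    exec_one; first exact: bd2.
    rewrite muln_gt0 /=.
    by apply: reaches_refl => //; rewrite /=; lia.
  have lt_rv : r v < u by rewrite ltn_neqAle le_rv andbT.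
  exec_one; first exact: bd2.
  rewrite ifT; last by lia.
  exec_one; first exact: bd2.
  have -> : 11 + 3 * u - 11 = 3 * u by lia.
  exec_one; first exact: bd2.
  rewrite muln_gt0 addn0 /=.
  by apply: reaches_refl => //; rewrite /=; lia.
have cardE := card_porbits_bypass r v.
have [u0|u0] := posnP u.
  exists (cnt + (r v == v)), (ptr (r v)), (ptr (r^-1 v)%g), h2; split=> //.
  (* Every vertex has been bypassed, so the permutation left is the identity, with [n] orbits. *)
  - have by1 : bypass r v = 1%g.
      by apply/permP => w; rewrite perm1; case: rem => _ -> //; rewrite u0.
    move: cardE; rewrite by1 card_porbits1 card_ord; lia.
  - by have := W_big; rewrite /ptr; lia.
  - by have := W_big; rewrite /ptr; lia.
  by move: R; rewrite u0.
have [|||||cnt' [hi' [t' [h' [eq_cnt lt_hi' lt_t' bd' R']]]]] := 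
  IH (bypass r v) h2 (cnt + (r v == v)) (ptr (r v)) (ptr (r^-1 v)%g) (3 * u) _ rem.
- lia.
- lia.
- by have := W_big; rewrite /ptr; lia.
- by have := W_big; rewrite /ptr; lia.
- by have := W_big; rewrite /ptr; lia.
exists cnt', hi', t', h'; split=> //; first by lia.
rewrite u0 in R; rewrite mulnS; exact: reaches_trans R R'.
Qed.

End Count.

(** * The complete run and its cost *)

Lemma index_program_reaches W n a b (s t : {perm 'I_n}) :
  0 < n -> ptr n + 3 < W ->
  all (fun x => 0 < x) a -> all (fun x => 0 < x) b ->
  sumn a = n -> sumn b = n -> involutive s -> involutive t ->
  (forall v : 'I_n, s v = partner 0 a v :> nat) ->
  (forall v : 'I_n, t v = partner 0 b v :> nat) ->
  exists l h inp, nth 0 l 0 = #|porbits (s * t)%g| - 1 /\ 0 < size l /\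
    reaches index_program W (64 * n) (init (encode_type a b)) (state 49 l h inp).
Proof.
move=> n0 W_big a0 b0 sum_a sum_b sK tK sE tE.
have a_neq0 : a != [::] by case: (a) sum_a n0 => //= <-.
have b_neq0 : b != [::] by case: (b) sum_b n0 => //= <-.
have W15 : 15 < W by move: W_big; rewrite /ptr; lia.
have lt_a v : v < n -> partner 0 a v < n.
  by move=> lt_vn; rewrite -(sE (Ordinal lt_vn)).
have lt_b v : v < n -> partner 0 b v < n.
  by move=> lt_vn; rewrite -(tE (Ordinal lt_vn)).
have aK v : v < n -> partner 0 a (partner 0 a v) = v.
  by move=> lt_vn; apply: partnerK; rewrite sum_a.
have bK v : v < n -> partner 0 b (partner 0 b v) = v.
  by move=> lt_vn; apply: partnerK; rewrite sum_b.
have bd0 (i : nat) : (fun _ : nat => 0) i < W by lia.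
pose h0 (i : nat) := 0.
have R0 : reaches index_program W 5 (init (encode_type a b))
    (state 5 (regs 0 (ptr 0) 0 0 0 0 0) h0 (encode_type a b)).
  apply: (@reaches_eqc _ _ _ _ (state 0 (nseq 11 0) h0 (encode_type a b))).
    have memory0 i : memory (nseq 11 0) h0 i = 0.
      by rewrite /memory nth_nseq; case: ifP => //; case: ifP.
    by split=> // i; apply/esym/memory0.
  do 5 (exec_one; first exact: bd0).
  by apply: reaches_refl => //; rewrite /=; lia.
have top0 : top_done W (partner 0 a) 0 h0 by [].
have lt0 : 0 < W by lia.
have [hi1 [t1 [tmp1 [h1 [lt_hi1 lt_t1 lt_tmp1 [bd1 top1] R1]]]]] :=
  @pass index_program W n 5 12 W_big erefl erefl erefl erefl erefl erefl
    erefl erefl erefl erefl erefl (partner 0 a) (top_done W (partner 0 a))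
    (fun u h H => proj1 H) (top_body W_big) a h0 (size b :: b) a_neq0 a0 sum_a top0
    (fun _ _ => erefl) 0 0 0 0 0 lt0 lt0 lt0 lt0 lt0.
have R1' : reaches index_program W 1
    (state 17 (regs 0 (ptr n) 0 0 hi1 t1 tmp1) h1 (size b :: b))
    (state 18 (regs 0 (ptr 0) 0 0 hi1 t1 tmp1) h1 (size b :: b)).
  have ltW := W_big; rewrite /ptr in ltW *; exec_one; first exact: bd1.
  by apply: reaches_refl => //; rewrite /=; lia.
have bot1 : bottom_done W n (partner 0 a) (partner 0 b) 0 h1 by [].
have bot_bd u h : bottom_done W n (partner 0 a) (partner 0 b) u h ->
  forall i, h i < W by case.
have := @pass index_program W n 18 29 W_big erefl erefl erefl erefl erefl erefl
    erefl erefl erefl erefl erefl (partner 0 b)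
    (bottom_done W n (partner 0 a) (partner 0 b))
    bot_bd (bottom_body W_big lt_a aK bK) b h1 [::] b_neq0 b0 sum_b bot1
    (fun _ _ => erefl) 0 0 hi1 t1 tmp1 lt0 lt0 lt_hi1 lt_t1 lt_tmp1.
rewrite cats0 => -[hi2 [t2 [tmp2 [h2 [lt_hi2 lt_t2 lt_tmp2 [bd2 _ bot2] R2]]]]].
have stV v : ((s * t)^-1 v)%g = s (t v).
  by apply: (@perm_inj _ (s * t)%g); rewrite permKV permM sK tK.
have rem : remaining W n (s * t)%g h2.
  split=> // [v|v _]; first by rewrite leqNgt ltn_ord.
  (* The image of [v] was stored during the visit to [s v], its preimage during the visit to
     [t v]. *)
  have [hF _] := bot2 _ (ltn_ord (s v)); have [_ hG] := bot2 _ (ltn_ord (t v)).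
  by move: hF hG; rewrite stV permM -!sE -!tE sK tK.
have [|//|cnt [hi3 [t3 [h3 [cntE lt_hi3 lt_t3 bd3 R3]]]]] :=
  count_loop (cnt := 0) W_big [::] _ rem _ lt_hi2 lt_t2 lt_tmp2; first by rewrite n0 /=.
have {}cntE : cnt = #|porbits (s * t)%g| by lia.
have le_cnt : cnt <= n by rewrite cntE -[X in _ <= X]card_ord leq_imset_card.
exists (regs (cnt - 1) 11 0 0 hi3 t3 0), h3, [::]; split; first by rewrite /= cntE.
split=> //.
have R4 : reaches index_program W 1
    (state 48 (regs cnt 11 0 0 hi3 t3 0) h3 [::])
    (state 49 (regs (cnt - 1) 11 0 0 hi3 t3 0) h3 [::]).
  have ltW := W_big; rewrite /ptr in ltW *; exec_one; first exact: bd3.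
  by apply: reaches_refl => //; rewrite /=; lia.
(* The budgets add up to [46 * n + 9], which is at most [64 * n] for positive [n]. *)
have R := reaches_trans (reaches_trans (reaches_trans (reaches_trans
  (reaches_trans R0 R1) R1') R2) R3) R4.
by apply: reaches_leq R; lia.
Qed.

Lemma leq_mul_expn n c : 0 < n -> 5 <= c -> n.+1 * 32 <= n.+1 ^ c.+1.
Proof.
move=> n0 c5; rewrite expnS leq_mul2l /= (leq_trans _ (leq_pexp2l _ c5)) //.
by rewrite (leq_exp2r 2 n.+1 (e := 5)).
Qed.

Theorem corollary3 :
  exists (P : program) (c : nat),
    forall (n : nat) (a b : seq nat),
      0 < n ->
      all (fun x => 0 < x) a -> all (fun x => 0 < x) b ->
      sumn a = n -> sumn b = n ->
      computes_within P (n.+1 ^ c) (c * n) (encode_type a b)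
        (meander_index n a b).
Proof.
(* One constant serves as time factor and as exponent of the word bound. The largest value needed is
   linear in [n], and [n.+1 >= 2] gives [n.+1 ^ 5 >= 32], which absorbs its coefficients. *)
exists index_program, 64 => n a b n0 a0 b0 sum_a sum_b.
have [s sK sE] := partner_perm sum_a; have [t tK tE] := partner_perm sum_b.
have W_big : ptr n + 3 < n.+1 ^ 64.
  apply: (@leq_trans (n.+1 * 32)); first by rewrite /ptr; lia.
  exact: (leq_mul_expn n0 (c := 63)).
have [l [h [inp [l0 [size_l [u le_u [[pcE _ regE] bd]]]]]]] :=
  index_program_reaches n0 W_big a0 b0 sum_a sum_b sK tK sE tE.
exists u; split=> //; first by rewrite /halted /run pcE.
  rewrite /run regE /= /memory size_l l0 /meander_index.
  by rewrite (index_porbits sK tK (mult_meander_edges sE tE)).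
by move=> v i le_v; apply: bd.
Qed.
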